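(* Let $K$ be a field of characteristic $2$ and let $q = 2^{\alpha}$ with $\alpha$ a positive integer. Let $n$ be an integer with $0 < n \leq q$, with consecutive-ones binary expansion $n = \sum_{1 \leq i \leq r} (-1)^{i+1} 2^{\beta_i}$, where $\beta_1 > \cdots > \beta_r \geq 0$. For $1 \leq k \leq r$ with $\beta_k > 0$, define $$d_k := 2^{\beta_k - 1} + \sum_{k < i \leq r} (-1)^{k+i} 2^{\beta_i}.$$ Then $$S^2(W_n) \cong W_1^{\lceil n/2 \rceil} \oplus \bigoplus_{\substack{1 \leq k \leq r \\ \beta_k > 0}} W_{2^{\beta_k}}^{d_k}$$ as $\mathfrak{w}_q$-modules.
   Context: The consecutive-ones binary expansion of an integer $n > 0$ is the alternating sum $n = \sum_{1 \leq i \leq r} (-1)^{i+1} 2^{\beta_i}$ such that $\beta_1 > \cdots > \beta_r \geq 0$ and $r$ is minimal (e.g. $3 = 2^2 - 2^0$, $4 = 2^2$, $5 = 2^3 - 2^2 + 2^0$, $6 = 2^3-2^1$). $\mathfrak{w}_q$ is the abelian $2$-Lie algebra (restricted Lie algebra) over $K$ generated by a single nilpotent element $e$ with $e^{[q]} = 0$, so $\mathfrak{w}_q = \bigoplus_{0 \leq i < \alpha} \langle e^{[2^i]} \rangle$ as a vector space. In a restricted module $e^{[2^i]}$ acts as the $2^i$-th power of the action of $e$, so a restricted $\mathfrak{w}_q$-module is the same as a $K$-vector space with an endomorphism $e$ such that $e^q = 0$. The indecomposable restricted $\mathfrak{w}_q$-modules are $W_1, \ldots, W_q$, where $\dim W_i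 = i$ and $e$ acts on $W_i$ as a single $i \times i$ nilpotent Jordan block. Set $W_0 = 0$. For a module $W$, $W^0 = 0$ and $W^d$ is the direct sum of $d$ copies of $W$ for $d>0$. The symmetric square $S^2(V)$ (the quotient of $V \otimes V$ by the span of the elements $v \otimes w - w \otimes v$) carries the Lie algebra action $e \cdot (vw) = (ev)w + v(ew)$. *)

(* Defs.v *)
From HB Require Import structures.
From mathcomp Require Import all_boot all_order all_algebra.

Set Implicit Arguments.
Unset Strict Implicit.
Unset Printing Implicit Defensive.

Import Order.TTheory GRing.Theory Num.Theory passmx.
Local Open Scope ring_scope.

Lemma linear_comb (K : fieldType) (V W : lmodType K) (h : V -> W) (I : finType)
    (a : I -> K) (v : I -> V) : linear h ->
  h (\sum_i a i *: v i) = \sum_i a i *: h (v i).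
Proof.
move=> hP; pose l : {linear V -> W} := HB.pack h
  (GRing.isSemilinear.Build K _ _ _ h (GRing.semilinear_linear hP)).
rewrite -[h]/(l : V -> W) linear_sum; apply: eq_bigr => i _; exact: linearZ.
Qed.

(* A 2-Lie algebra (restricted Lie algebra over a field of characteristic 2)  *)
(* on a finite-dimensional vector space; sqm x is x^[2].                      *)
Record lie2 (K : fieldType) := Lie2 {
  lie2_sort :> vectType K;
  br : lie2_sort -> lie2_sort -> lie2_sort;
  sqm : lie2_sort -> lie2_sort;
  br_linearl : forall y, linear (br^~ y);
  br_linearr : forall x, linear (br x);
  brxx : forall x, br x x = 0;
  br_jacobi : forall x y z, br x (br y z) + br y (br z x) + br z (br x y) = 0;
  sqmZ : forall (a : K) x, sqm (a *: x) = a ^+ 2 *: sqm x;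
  sqmD : forall x y, sqm (x + y) = sqm x + sqm y + br x y;
  br_sqm : forall x y, br (sqm x) y = br x (br x y)
}.

Record liemod (K : fieldType) (L : lie2 K) := Liemod {
  liemod_sort :> vectType K;
  act : L -> 'End(liemod_sort);
  act_linear : linear act;
  act_br : forall x y,
    act (br x y) = (act x \o act y)%VF - (act y \o act x)%VF
}.
Arguments act {K L l} x.

Definition restricted (K : fieldType) (L : lie2 K) (M : liemod L) : Prop :=
  forall x : L, act (l := M) (sqm x) = (act x \o act x)%VF.

Definition liemod_iso (K : fieldType) (L : lie2 K) (M N : liemod L) : Prop :=
  exists f : {linear M -> N},
    bijective f /\ forall (x : L) (v : M), f (act x v) = act x (f v).

Section DirectSum.
Variables (K : fieldType) (L : lie2 K) (M N : liemod L).

Definition dsum_fun (x : L) (u : M * N) : M * N := (act x u.1, act x u.2).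

Fact dsum_fun_linear x : linear (dsum_fun x).
Proof. by move=> a u v; rewrite /dsum_fun /= !linearP. Qed.

HB.instance Definition _ x := GRing.isSemilinear.Build K (M * N)%type (M * N)%type
  _ (dsum_fun x) (GRing.semilinear_linear (dsum_fun_linear x)).

Definition dsum_act (x : L) : 'End((M * N)%type) := linfun (dsum_fun x).

Lemma dsum_actE x u : dsum_act x u = (act x u.1, act x u.2).
Proof. by rewrite lfunE. Qed.

Fact dsum_act_linear : linear dsum_act.
Proof.
move=> a x y; apply/lfunP => u; rewrite add_lfunE scale_lfunE !dsum_actE.
by rewrite !act_linear !add_lfunE !scale_lfunE.
Qed.

Fact dsum_act_br x y : dsum_act (br x y) =
  (dsum_act x \o dsum_act y)%VF - (dsum_act y \o dsum_act x)%VF.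
Proof.
apply/lfunP => u; rewrite add_lfunE opp_lfunE !comp_lfunE !dsum_actE /=.
by rewrite !act_br !add_lfunE !opp_lfunE !comp_lfunE.
Qed.

Definition dsum : liemod L := Liemod dsum_act_linear dsum_act_br.

Lemma restricted_dsum : restricted M -> restricted N -> restricted dsum.
Proof.
move=> rM rN x; apply/lfunP => u /=; rewrite comp_lfunE !dsum_actE /=.
by rewrite rM rN !comp_lfunE.
Qed.

End DirectSum.

Section TensorSquare.
Variables (K : fieldType) (V : vectType K).

(* V (x) V in coordinates: the matrix X stands for the sum of the             *)
(* X i j *: (b_i (x) b_j), where b := vbasis {:V}.                            *)
Definition tensor2 : Type := 'M[K]_(\dim {:V}).
HB.instance Definition _ := Vector.on tensor2.

Definition tens (v w : V) : tensor2 :=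
  (rVof (vbasis {:V}) v)^T *m rVof (vbasis {:V}) w.

Lemma tens_linearl w : linear (tens^~ w).
Proof. by move=> a u v; rewrite /tens linearP /= linearP /= mulmxDl scalemxAl. Qed.

Lemma tens_linearr v : linear (tens v).
Proof. by move=> a u w; rewrite /tens linearP /= mulmxDr scalemxAr. Qed.

Lemma tens_vbasis (i j : 'I_(\dim {:V})) :
  tens (vbasis {:V})`_i (vbasis {:V})`_j = delta_mx i j.
Proof. by rewrite /tens !rVofE ?vbasisP // trmx_delta mul_delta_mx. Qed.

Lemma tensor2_sum (X : tensor2) :
  X = \sum_i \sum_j X i j *: tens (vbasis {:V})`_i (vbasis {:V})`_j.
Proof.
rewrite [LHS](matrix_sum_delta (X : 'M_(\dim {:V}))).
by apply: eq_bigr => i _; apply: eq_bigr => j _; rewrite tens_vbasis.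
Qed.

Lemma tens_universal (U : lmodType K) (B : V -> V -> U) :
    (forall w, linear (B^~ w)) -> (forall v, linear (B v)) ->
  exists2 g : tensor2 -> U,
    linear g & (forall v w, g (tens v w) = B v w) /\
    (forall h : tensor2 -> U, linear h ->
      (forall v w, h (tens v w) = B v w) -> h =1 g).
Proof.
move=> Bl Br; set b := vbasis {:V}.
pose g (X : tensor2) := \sum_i \sum_j X i j *: B b`_i b`_j.
have gP : linear g.
  move=> a X Y; rewrite /g scaler_sumr -big_split; apply: eq_bigr => i _ /=.
  rewrite scaler_sumr -big_split; apply: eq_bigr => j _ /=.
  by rewrite !mxE scalerDl scalerA.
exists g => //; split=> [v w|h hP hB X].
  rewrite [in RHS](coord_vbasis (memvf v)).
  rewrite [RHS](linear_comb _ _ (Bl w)); apply: eq_bigr => i _.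
  rewrite [in RHS](coord_vbasis (memvf w)) (linear_comb _ _ (Br _)) scaler_sumr.
  apply: eq_bigr => j _; rewrite scalerA; congr (_ *: _).
  by rewrite !mxE big_ord1 !mxE.
rewrite {1}[X]tensor2_sum pair_big /= (linear_comb _ _ hP) /g pair_big /=.
by apply: eq_bigr => -[i j] _; rewrite hB.
Qed.

(* f (x) 1 + 1 (x) f *)
Definition derivt (f : 'End(V)) (X : tensor2) : tensor2 :=
  let A := mxof (vbasis {:V}) (vbasis {:V}) f in A^T *m X + X *m A.

Fact derivt_linear f : linear (derivt f).
Proof.
move=> a X Y; rewrite /derivt mulmxDr mulmxDl scalerDr -!scalemxAr -!scalemxAl.
by rewrite addrACA.
Qed.

HB.instance Definition _ f := GRing.isSemilinear.Build K tensor2 tensor2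
  _ (derivt f) (GRing.semilinear_linear (derivt_linear f)).

Lemma derivt_linearl X : linear (derivt^~ X).
Proof.
move=> a f g; rewrite /derivt mxof_linear [(_ + _)^T]linearP /=.
by rewrite mulmxDl mulmxDr -scalemxAl -scalemxAr scalerDr addrACA.
Qed.

Lemma derivt_br f g X : derivt ((f \o g)%VF - (g \o f)%VF) X =
  derivt f (derivt g X) - derivt g (derivt f X).
Proof.
rewrite addrC -scaleN1r derivt_linearl scaleN1r addrC /derivt.
rewrite !(mxof_comp _ _ (vbasisP {:V})) !trmx_mul.
set A := mxof _ _ f; set B := mxof _ _ g.
rewrite !(mulmxDl, mulmxDr, mulmxA).
rewrite [in LHS]opprD [in LHS]addrACA.
rewrite [X in _ = X - _]addrACA [in RHS]opprD [RHS]addrACA.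
by congr (_ + _); rewrite opprD addrACA subrr ?addr0 ?add0r.
Qed.

Lemma derivt_tens f v w : derivt f (tens v w) = tens (f v) w + tens v (f w).
Proof.
rewrite /derivt /tens !(rVof_app _ (vbasisP {:V})) ?vbasisP // trmx_mul.
by rewrite !mulmxA.
Qed.

(* Basis vectors v and w suffice, see tens_swap_mem.                          *)
Definition symrel : {vspace tensor2} :=
  <<[seq tens v w - tens w v | v <- vbasis {:V}, w <- vbasis {:V}]>>%VS.

Lemma tens_swap_mem v w : tens v w - tens w v \in symrel.
Proof.
rewrite (coord_vbasis (memvf v)).
rewrite [X in X - _](linear_comb _ _ (tens_linearl w)).
rewrite (linear_comb _ _ (tens_linearr w)) -sumrB; apply: rpred_sum => i _.
rewrite -scalerBr rpredZ //; set vi := _`_i; rewrite (coord_vbasis (memvf w)).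
rewrite [X in _ - X](linear_comb _ _ (tens_linearl vi)).
rewrite (linear_comb _ _ (tens_linearr vi)) -sumrB; apply: rpred_sum => j _.
rewrite -scalerBr rpredZ // memv_span //.
by apply/allpairsP; exists (vi, (vbasis {:V})`_j); rewrite !mem_nth ?size_tuple.
Qed.

Lemma symrel_min (U : {vspace tensor2}) :
  (forall v w, tens v w - tens w v \in U) -> (symrel <= U)%VS.
Proof. by move=> UP; apply/span_subvP => _ /allpairsP[[v w] [_ _ ->]]. Qed.

Lemma derivt_symrel f X : X \in symrel -> derivt f X \in symrel.
Proof.
have -> : derivt f X = linfun (derivt f) X by rewrite lfunE.
suff: (linfun (derivt f) @: symrel <= symrel)%VS.
  by move/subvP => sub XU; apply/sub/memv_img.
rewrite limg_span; apply/span_subvP => _ /mapP[_ /allpairsP[[v w] [_ _ ->]] ->] /=.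
rewrite lfunE /= linearB /= !derivt_tens [X in _ - X]addrC opprD addrACA.
by rewrite rpredD ?tens_swap_mem.
Qed.

End TensorSquare.

Section Quotient.
Variables (K : fieldType) (V : vectType K) (U : {vspace V}).

(* The quotient of V by U, carried by a complement of U; it is characterised  *)
(* by qpi_ker and qpi_surj.                                                   *)
Definition quotv : Type := subvs_of (U^C)%VS.
HB.instance Definition _ := Vector.on quotv.

Definition qpi : 'Hom(V, quotv) :=
  linfun (vsproj (U^C)%VS \o daddv_pi (U^C)%VS U).

Fact capCv : (U^C :&: U = 0)%VS.
Proof. by rewrite capvC capv_compl. Qed.

Lemma vsval_qpi v : vsval (qpi v) = daddv_pi (U^C)%VS U v.
Proof. by rewrite lfunE /= vsprojK ?memv_pi. Qed.

Lemma qpi_vsval (x : quotv) : qpi (vsval x) = x.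
Proof. by apply: subvs_inj; rewrite vsval_qpi daddv_pi_id ?capCv ?subvsP. Qed.

Lemma qpi_eq0 v : (qpi v == 0) = (v \in U).
Proof.
have dec : daddv_pi (U^C)%VS U v + daddv_pi U (U^C)%VS v = v.
  by apply: daddv_pi_add capCv _; rewrite addvC addv_complf memvf.
apply/eqP/idP => [pi0|vU].
  by rewrite -dec -vsval_qpi pi0 add0r memv_pi.
apply: subvs_inj; rewrite vsval_qpi.
by apply: (addIr v); rewrite -{2}(daddv_pi_id (capv_compl U) vU) dec add0r.
Qed.

Lemma qpi_ker : lker qpi = U.
Proof. by apply/vspaceP => v; rewrite memv_ker qpi_eq0. Qed.

Lemma qpi_surj : limg qpi = fullv.
Proof.
apply/vspaceP => x; rewrite memvf -[x]qpi_vsval.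
by apply/memv_img/memvf.
Qed.

End Quotient.

Section SymmetricSquare.
Variables (K : fieldType) (L : lie2 K) (M : liemod L).

Definition sym2_sort : vectType K := quotv (symrel M).

Definition sprod (v w : M) : sym2_sort := qpi (symrel M) (tens v w).

Definition sym2_map (f : 'End(M)) : 'End(sym2_sort) :=
  linfun (qpi (symrel M) \o derivt f \o vsval).

Lemma sym2_map_pi f X :
  sym2_map f (qpi (symrel M) X) = qpi (symrel M) (derivt f X).
Proof.
rewrite lfunE /=; apply/eqP; rewrite -subr_eq0 -linearB /= -linearB /=.
rewrite qpi_eq0 derivt_symrel // -qpi_eq0 linearB /= qpi_vsval subrr //.
Qed.

Lemma sym2_ind (P : sym2_sort -> Prop) :
  (forall X, P (qpi (symrel M) X)) -> forall u, P u.
Proof. by move=> PX u; rewrite -(qpi_vsval (u : quotv _)). Qed.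

Definition sym2_act (x : L) : 'End(sym2_sort) := sym2_map (act x).

Lemma sym2_act_sprod x v w :
  sym2_act x (sprod v w) = sprod (act x v) w + sprod v (act x w).
Proof. by rewrite /sym2_act /sprod sym2_map_pi derivt_tens linearD. Qed.

Fact sym2_act_linear : linear sym2_act.
Proof.
move=> a x y; apply/lfunP; elim/sym2_ind => X.
rewrite add_lfunE scale_lfunE !sym2_map_pi -linearP; congr (qpi _ _).
by rewrite act_linear derivt_linearl.
Qed.

Fact sym2_act_br x y : sym2_act (br x y) =
  (sym2_act x \o sym2_act y)%VF - (sym2_act y \o sym2_act x)%VF.
Proof.
apply/lfunP; elim/sym2_ind => X.
rewrite add_lfunE opp_lfunE !comp_lfunE !sym2_map_pi -linearB; congr (qpi _ _).
by rewrite act_br derivt_br.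
Qed.

Definition sym2 : liemod L := Liemod sym2_act_linear sym2_act_br.

Lemma restricted_sym2 : 2%N \in [pchar K] -> restricted M -> restricted sym2.
Proof.
move=> chK rM x; apply/lfunP; elim/sym2_ind => X /=.
rewrite comp_lfunE !sym2_map_pi rM; congr (qpi _ _).
rewrite /derivt (mxof_comp _ _ (vbasisP {:M})) trmx_mul.
set A := mxof _ _ _; rewrite !(mulmxDl, mulmxDr, mulmxA).
have uu : A^T *m X *m A + A^T *m X *m A = 0.
  by rewrite -mulr2n -scaler_nat (pcharf0 chK) scale0r.
by rewrite -[RHS]addrA [in RHS](addrA (A^T *m X *m A)) uu add0r.
Qed.

End SymmetricSquare.

Section Wq.
Variables (K : fieldType) (chK : 2%N \in [pchar K]) (alpha : nat).

(* The algebra w_q for q = 2 ^ alpha: delta_mx 0 i stands for e^[2^i], so     *)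
(* that e = delta_mx 0 0 and e^[q] = 0.                                       *)
Let T := 'rV[K]_alpha.

Definition wq_br (x y : T) : T := 0.

Definition wq_sqm (x : T) : T :=
  \row_j \sum_(i < alpha | i.+1 == j) x 0 i ^+ 2.

Fact wq_br_linearl y : linear (wq_br^~ y).
Proof. by move=> a u v; rewrite scaler0 addr0. Qed.

Fact wq_br_linearr x : linear (wq_br x).
Proof. by move=> a u v; rewrite scaler0 addr0. Qed.

Fact wq_brxx x : wq_br x x = 0. Proof. by []. Qed.

Fact wq_br_jacobi x y z :
  wq_br x (wq_br y z) + wq_br y (wq_br z x) + wq_br z (wq_br x y) = 0.
Proof. by rewrite !addr0. Qed.

Fact wq_sqmZ (a : K) x : wq_sqm (a *: x) = a ^+ 2 *: wq_sqm x.
Proof.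
apply/rowP => j; rewrite !mxE mulr_sumr; apply: eq_bigr => i _.
by rewrite mxE exprMn.
Qed.

Fact wq_sqmD x y : wq_sqm (x + y) = wq_sqm x + wq_sqm y + wq_br x y.
Proof.
rewrite addr0; apply/rowP => j; rewrite !mxE -big_split.
by apply: eq_bigr => i _; rewrite mxE /= -!(pFrobenius_autE chK) pFrobenius_autD_comm //; exact: mulrC.
Qed.

Fact wq_br_sqm x y : wq_br (wq_sqm x) y = wq_br x (wq_br x y).
Proof. by []. Qed.

Definition wq : lie2 K := Lie2 wq_br_linearl wq_br_linearr wq_brxx wq_br_jacobi
  wq_sqmZ wq_sqmD wq_br_sqm.

Definition wq_e (i : 'I_alpha) : wq := delta_mx 0 i.

Lemma wq_e_sqm (i j : 'I_alpha) : i.+1 = j -> sqm (wq_e i) = wq_e j.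
Proof.
move=> ij; apply/rowP => k; rewrite !mxE big_mkcond (bigD1 i) //= mxE !eqxx.
rewrite big1 => [|l /negPf li]; last by rewrite mxE li andbF expr0n if_same.
by rewrite addr0 expr1n ij eq_sym -val_eqE /=; case: ifP.
Qed.

Lemma wq_e_sqm_last (i : 'I_alpha) : i.+1 = alpha -> sqm (wq_e i) = 0.
Proof.
move=> ij; apply/rowP => k; rewrite !mxE big1 // => l /eqP lk.
rewrite mxE eqxx; have [li|_] /= := eqVneq l i; last by rewrite expr0n.
by have := ltn_ord k; rewrite -lk li ij ltnn.
Qed.

Definition jordan0 (n : nat) : 'M[K]_n := \matrix_(i, j) (i.+1 == j :> nat)%:R.

Lemma jordan0X n k (i j : 'I_n) : (jordan0 n ^+ k) i j = (i + k == j)%N%:R.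
Proof.
elim: k i => [|k IHk] i; first by rewrite expr0 mxE addn0.
rewrite exprS -mulmxE mxE; have [lt_i1|ge_i1] := ltnP i.+1 n.
  rewrite (bigD1 (Ordinal lt_i1)) //= mxE eqxx mul1r IHk addnS addSn.
  rewrite big1 ?addr0 // => l; rewrite -val_eqE /= => /negPf li.
  by rewrite mxE eq_sym li mul0r.
rewrite big1 => [|l _].
  by rewrite gtn_eqF // (leq_trans (ltn_ord j)) // (leq_trans ge_i1) // addnS ltnS leq_addr.
by rewrite mxE gtn_eqF ?mul0r // (leq_trans (ltn_ord l)).
Qed.

Lemma jordan0_nilp n k : (n <= k)%N -> jordan0 n ^+ k = 0.
Proof.
move=> le_nk; apply/matrixP => i j; rewrite jordan0X mxE gtn_eqF //.
by rewrite (leq_trans (ltn_ord j)) // (leq_trans le_nk) ?leq_addl.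
Qed.

(* e^[2^i] acts as the (2^i)-th power of the Jordan block                     *)
Definition jordan_mx n (x : wq) : 'M[K]_n :=
  \sum_(i < alpha) (x : T) 0 i *: jordan0 n ^+ (2 ^ i).

Definition jordan_act n (x : wq) : 'End('cV[K]_n) := linfun (mulmx (jordan_mx n x)).

Lemma jordan_actE n x v : jordan_act n x v = jordan_mx n x *m v.
Proof. by rewrite lfunE. Qed.

Lemma jordan_mx_e n (i : 'I_alpha) : jordan_mx n (wq_e i) = jordan0 n ^+ (2 ^ i).
Proof.
rewrite /jordan_mx (bigD1 i) //= big1 ?addr0 => [|j /negPf ji].
  by rewrite mxE !eqxx scale1r.
by rewrite mxE ji andbF scale0r.
Qed.

Fact jordan_act_linear n : linear (jordan_act n).
Proof.
move=> a x y; apply/lfunP => v; rewrite add_lfunE scale_lfunE !jordan_actE.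
rewrite scalemxAl -mulmxDl; congr (_ *m v).
rewrite /jordan_mx scaler_sumr -big_split; apply: eq_bigr => i _ /=.
by rewrite !mxE scalerDl scalerA.
Qed.

Lemma jordan_mx_comm n x y :
  jordan_mx n x *m jordan_mx n y = jordan_mx n y *m jordan_mx n x.
Proof.
rewrite !mulmxE; apply: commr_sum => i _; apply/commr_sym/commr_sum => j _.
rewrite /GRing.comm -!mulmxE -!scalemxAl -!scalemxAr !scalerA mulrC.
by rewrite !mulmxE -!exprD addnC.
Qed.

Fact jordan_act_br n x y : jordan_act n (br x y) =
  (jordan_act n x \o jordan_act n y)%VF - (jordan_act n y \o jordan_act n x)%VF.
Proof.
apply/lfunP => v; rewrite add_lfunE opp_lfunE !comp_lfunE !jordan_actE !mulmxA.
rewrite jordan_mx_comm subrr /jordan_mx big1 ?mul0mx // => i _.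
by rewrite mxE scale0r.
Qed.

Definition W (n : nat) : liemod wq := Liemod (@jordan_act_linear n) (@jordan_act_br n).

Lemma jordan_mx_sqm n x : (n <= 2 ^ alpha)%N ->
  jordan_mx n (sqm x) = jordan_mx n x *m jordan_mx n x.
Proof.
move=> le_nq; set F := fun i : 'I_alpha => (x : T) 0 i *: jordan0 n ^+ (2 ^ i).
have Fcomm i j : GRing.comm (F i) (F j).
  rewrite /GRing.comm -!mulmxE -!scalemxAl -!scalemxAr !scalerA mulrC.
  by rewrite !mulmxE -!exprD addnC.
have sumX (r : seq 'I_alpha) :
    (\sum_(i <- r) F i) * (\sum_(i <- r) F i) = \sum_(i <- r) F i * F i.
  elim: r => [|i r IHr]; first by rewrite !big_nil mul0r.
  rewrite !big_cons mulrDl !mulrDr IHr -!addrA; congr (_ + _); rewrite addrA.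
  rewrite (_ : (\sum_(j <- r) F j) * F i = F i * \sum_(j <- r) F j); last first.
    by apply: commr_sym; apply: commr_sum => j _; apply: Fcomm.
  by rewrite -mulr2n -scaler_nat (pcharf0 chK) scale0r add0r.
rewrite [RHS]sumX; apply/esym.
transitivity (\sum_(i < alpha) (x : T) 0 i ^+ 2 *: jordan0 n ^+ (2 ^ i.+1)).
  apply: eq_bigr => i _; rewrite /F -!mulmxE -scalemxAl -scalemxAr scalerA.
  by rewrite mulmxE -exprD addnn -mul2n -expnS.
have ordS_sum (i : 'I_alpha) : (x : T) 0 i ^+ 2 *: jordan0 n ^+ (2 ^ i.+1) =
    \sum_(j < alpha | i.+1 == j) (x : T) 0 i ^+ 2 *: jordan0 n ^+ (2 ^ j).
  have [lt_i1|ge_i1] := ltnP i.+1 alpha.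
    by rewrite (big_pred1 (Ordinal lt_i1)) // => j; rewrite eq_sym.
  rewrite jordan0_nilp ?scaler0 ?big1 // => [j /eqP ij|].
    by have := ltn_ord j; rewrite -ij ltnNge ge_i1.
  by rewrite (leq_trans le_nq) ?leq_exp2l.
rewrite (eq_bigr _ (fun i _ => ordS_sum i)).
rewrite (exchange_big_dep predT) //=; apply: eq_bigr => j _.
by rewrite mxE scaler_suml.
Qed.

Lemma restricted_W n : (n <= 2 ^ alpha)%N -> restricted (W n).
Proof.
move=> le_nq x; apply/lfunP => v.
by rewrite comp_lfunE /= !jordan_actE jordan_mx_sqm // mulmxA.
Qed.

End Wq.

Definition dpow (K : fieldType) (chK : 2%N \in [pchar K]) (alpha : nat)
    (M : liemod (wq chK alpha)) (d : nat) : liemod (wq chK alpha) :=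
  iter d (dsum M) (W chK alpha 0).

(* The exponents beta_1 > ... > beta_r are the entries of b, numbered from 0, *)
(* so that the sign (-1)^(i+1) becomes (-1)^i.                                *)
Definition altsum (b : seq nat) : int :=
  \sum_(i < size b) (-1) ^+ i * (2 ^ nth 0%N b i)%N%:Z.

Definition consecutive_ones (n : nat) (b : seq nat) : Prop :=
  [/\ sorted gtn b, altsum b = n%:Z &
     forall c : seq nat, sorted gtn c -> altsum c = n%:Z -> (size b <= size c)%N].

(* d_(k+1) in the 1-based numbering, meaningful when beta_(k+1) > 0; it is    *)
(* then nonnegative by dcoef_ge0.                                             *)
Definition dcoef (b : seq nat) (k : nat) : int :=
  (2 ^ (nth 0%N b k).-1)%N%:Z
    + \sum_(k.+1 <= i < size b) (-1) ^+ (k + i) * (2 ^ nth 0%N b i)%N%:Z.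

Lemma altsum_cons x b : altsum (x :: b) = (2 ^ x)%N%:Z - altsum b.
Proof.
rewrite /altsum /= big_ord_recl /= expr0 mul1r; congr (_ + _).
rewrite -sumrN; apply: eq_bigr => i _; rewrite /= /bump /= add1n exprS.
by rewrite !mulN1r mulNr.
Qed.

Lemma altsum_bound x b : sorted gtn (x :: b) -> 0 < altsum (x :: b) <= (2 ^ x)%N%:Z.
Proof.
elim: b x => [|y b IHb] x.
  by rewrite altsum_cons /altsum big_ord0 subr0 lexx ltz_nat expn_gt0.
rewrite /= => /andP[lt_yx sb]; have /andP[gt0 le] := IHb y sb.
rewrite altsum_cons subr_gt0 lerBlDr lerDl ltW // andbT.
by apply: le_lt_trans le _; rewrite ltz_nat ltn_exp2l.
Qed.

Lemma dcoef_drop b k : (k < size b)%N ->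
  dcoef b k = (2 ^ (nth 0%N b k).-1)%N%:Z - altsum (drop k.+1 b).
Proof.
move=> ltk; rewrite /dcoef /altsum size_drop; congr (_ + _).
rewrite -{1}[k.+1]add0n big_addn big_mkord -sumrN; apply: eq_bigr => i _.
rewrite nth_drop addnC -mulNr; congr (_ * _).
  rewrite -[RHS]mulN1r -exprS -signr_odd -[RHS]signr_odd; congr (_ ^+ nat_of_bool _).
  by rewrite addnS addSn /= -addnA oddD addnn odd_double addbF.
by rewrite addnC.
Qed.

Lemma dcoef_ge0 b k :
  sorted gtn b -> (k < size b)%N -> (0 < nth 0%N b k)%N -> 0 <= dcoef b k.
Proof.
move=> sb ltk bk; rewrite dcoef_drop // subr_ge0.
have := drop_sorted k sb; rewrite (drop_nth 0%N ltk).
case: (drop k.+1 b) => [_|y c /= /andP[lt_y sc]].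
  by rewrite /altsum big_ord0.
have /andP[_ le] := altsum_bound sc; apply: le_trans le _.
by rewrite lez_nat leq_exp2l // -ltnS prednK.
Qed.

(* Main.v *)
(* Write W_n as K[x]/(x^n).  Then S^2(W_n) is spanned by the classes B i j of  *)
(* x^i y^j, with B i j = B j i, and e multiplies by s = x + y; put p = x y.   *)
(* In characteristic 2, e kills the squares p^i = B i i, and s^(2^t) =        *)
(* x^(2^t) + y^(2^t), so that S^2(W_n) is generated over K[e] by the p^i and  *)
(* the x p^i = B i.+1 i.                                                      *)
(*   Let n = 2^(t+1) - n' = 2^t + h with n' = 2^t - h.  For i < h the vector  *)
(* x p^i generates a free K[s]/(s^(2^(t+1)))-module, since s^(2^(t+1)-1) maps *)
(* it to the nonzero square p^(i + 2^t).  Modulo these h blocks, p^h x^i y^j  *)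
(* vanishes as soon as i >= n', so that p^h S^2 behaves like S^2(W_n') and    *)
(* one iterates along the expansion of n, which yields d_k = h at each stage. *)
(* Generators found modulo the earlier blocks lift to generators killed by    *)
(* the same power of e, because those blocks are free.  The resulting chains  *)
(* and uphalf n squares span, and their total length is dim S^2(W_n).         *)

Require Import Defs.
From HB Require Import structures.
From mathcomp Require Import all_boot all_order all_algebra.
From mathcomp Require Import zify.

Set Implicit Arguments.
Unset Strict Implicit.
Unset Printing Implicit Defensive.

Import Order.TTheory GRing.Theory Num.Theory.
Local Open Scope ring_scope.

(** The isomorphism is built from right to left. In a restricted module [e] determines the whole
    action ([act_wq]), so a map out of a sum of Jordan blocks amounts to a choice of vectors killed
    by the right powers of [e] ([free_on]). Each W_1 goes to a square p^i with i < [uphalf n], and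
    the i-th entry of [block_sizes] to a corrected version of x p^i. The map is onto because [B_gen]
    reduces everything to the p^i and x p^i, and those beyond the chosen range lie in the span of
    the chains. A dimension count ([sumn_block_sizes], [dim_sym2]) makes it bijective. The corrected
    generators come from [square_chains], an induction along the expansion with invariants
    [gspan_big] and [gspan_sq_free]. In one stage, [iter_eB_pred] exhibits squares as socles of the
    new blocks, [gspan_div] turns their independence into freeness, and [gspan_big_step] and
    [gspan_sq_free_step] carry the invariants to the next stage. *)

(** * Submodules generated under a linear endomorphism *)

Section Iterates.
Variables (K : fieldType) (M : lmodType K) (e : {linear M -> M}).

Fact iter_is_linear k : linear (iter k e).
Proof. by move=> c x y; elim: k => //= k ->; rewrite linearP. Qed.

HB.instance Definition _ k := GRing.isSemilinear.Build K M M _ (iter k e)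
  (GRing.semilinear_linear (iter_is_linear k)).

Inductive esub (P : M -> Prop) : M -> Prop :=
| esub_gen x : P x -> esub P x
| esub0 : esub P 0
| esubP c x y : esub P x -> esub P y -> esub P (c *: x + y)
| esubE x : esub P x -> esub P (e x).

Lemma esubD P x y : esub P x -> esub P y -> esub P (x + y).
Proof. by move=> Px Py; rewrite -[x]scale1r; apply: esubP. Qed.

Lemma esubZ P c x : esub P x -> esub P (c *: x).
Proof. by move=> Px; rewrite -[_ *: x]addr0; apply: esubP => //; apply: esub0. Qed.

Lemma esubN P x : esub P x -> esub P (- x).
Proof. by rewrite -scaleN1r; apply: esubZ. Qed.

Lemma esubB P x y : esub P x -> esub P y -> esub P (x - y).
Proof. by move=> Px Py; apply/esubD/esubN. Qed.

Lemma esub_addl P x y : esub P x -> esub P (x + y) -> esub P y.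
Proof. by move=> Px Pxy; rewrite -(addKr x y) addrC; apply: esubB. Qed.

Lemma esub_iter P k x : esub P x -> esub P (iter k e x).
Proof. by move=> Px; elim: k => //= k; apply: esubE. Qed.

Lemma esub_sum P (r : seq nat) (p : pred nat) (x : nat -> M) :
  (forall i, p i -> esub P (x i)) -> esub P (\sum_(i <- r | p i) x i).
Proof. by move=> Px; elim/big_rec: _ => [|i y pi Py]; [exact: esub0|apply: esubD => //; exact: Px]. Qed.

Lemma esub_map (P Q : M -> Prop) k x :
  (forall y, P y -> esub Q (iter k e y)) -> esub P x -> esub Q (iter k e x).
Proof.
move=> PQ; elim=> [y /PQ //||c y z _ Qy _ Qz|y _ Qy].
- by rewrite linear0; apply: esub0.
- by rewrite linearP; apply: esubP.
- by rewrite -iterSr iterS; apply: esubE.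
Qed.

Lemma esub_trans (P Q : M -> Prop) x :
  (forall y, P y -> esub Q y) -> esub P x -> esub Q x.
Proof. exact: (@esub_map P Q 0). Qed.

End Iterates.

(** * Arithmetic of the expansion and of the block lengths *)

Definition altnat (b : seq nat) : nat := `|altsum b|%N.

Lemma altsum_altnat b : sorted gtn b -> altsum b = (altnat b)%:Z.
Proof.
case: b => [_|x b /altsum_bound /andP[gt0 _]]; last by rewrite /altnat gtz0_abs.
by rewrite /altnat /altsum big_ord0.
Qed.

Lemma altnat_le t b : path gtn t.+1 b -> (altnat b <= 2 ^ t)%N.
Proof.
case: b => [_|y b /= /andP[lt_y sb]]; first by rewrite /altnat /altsum big_ord0.
have /andP[_] := altsum_bound sb; rewrite altsum_altnat // lez_nat => /leq_trans; apply.
by rewrite leq_exp2l.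
Qed.

Lemma altnat_cons x b : path gtn x b -> altnat (x :: b) = (2 ^ x - altnat b)%N.
Proof.
move=> sb; have /andP[gt0 _] := altsum_bound (sb : sorted gtn (x :: b)).
move: gt0; rewrite /altnat altsum_cons (altsum_altnat (path_sorted sb)).
by rewrite /altnat; lia.
Qed.

Lemma dcoef_cons0 t b : path gtn t.+1 b ->
  `|dcoef (t.+1 :: b) 0|%N = (2 ^ t - altnat b)%N.
Proof.
move=> sb; have := altnat_le sb.
by rewrite dcoef_drop //= drop0 (altsum_altnat (path_sorted sb)); lia.
Qed.

Lemma dcoef_consS x b k : (k < size b)%N -> dcoef (x :: b) k.+1 = dcoef b k.
Proof. by move=> lt_k; rewrite !dcoef_drop. Qed.

(** An ordered list, because entry i is the length of the chain attached to x p^i; the blocks of the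
    leading exponent come first. *)
Definition block_sizes (b : seq nat) : seq nat :=
  \big[cat/[::]]_(k < size b | (0 < nth 0%N b k)%N)
     nseq `|dcoef b k|%N (2 ^ nth 0%N b k)%N.

Lemma block_sizes_cons x b : block_sizes (x :: b) =
  (if (0 < x)%N then nseq `|dcoef (x :: b) 0|%N (2 ^ x)%N else [::]) ++ block_sizes b.
Proof.
rewrite /block_sizes big_mkcond [in RHS]big_mkcond big_ord_recl /=; congr (_ ++ _).
by apply: eq_bigr => k _; rewrite add0n dcoef_consS.
Qed.

Lemma block_sizes_nil : block_sizes [::] = [::].
Proof. by rewrite /block_sizes big_ord0. Qed.

Lemma block_sizes_le x b : path gtn x b -> all (leq^~ (2 ^ x)%N) (block_sizes b).
Proof.
move=> sb; have /allP le_x := order_path_min (rev_trans ltn_trans) sb.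
rewrite /block_sizes; elim/big_ind: _ => // [s1 s2 h1 h2|k _]; first by rewrite all_cat h1.
by rewrite all_nseq leq_exp2l // ltnW ?orbT // le_x // mem_nth.
Qed.

Lemma size_block_sizes b : sorted gtn b -> size (block_sizes b) = (altnat b)./2.
Proof.
elim: b => [_|x b IHb sb]; first by rewrite block_sizes_nil /altnat /altsum big_ord0.
rewrite block_sizes_cons size_cat IHb ?(path_sorted sb) // (altnat_cons sb).
case: x sb => [|t] sb.
  by case: b sb {IHb} => // _; rewrite /altnat /altsum big_ord0.
rewrite /= size_nseq dcoef_cons0 //; have := altnat_le sb; rewrite expnS; lia.
Qed.

(** The dimension count. With a the value of the tail and n = a + 2h, the leading exponent
    contributes h blocks of length 2(h + a) and h further squares, and C(n+1, 2) - C(a+1, 2) = h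
    (2(h + a) + 1). *)
Lemma sumn_block_sizes b : sorted gtn b ->
  (uphalf (altnat b) + sumn (block_sizes b) = 'C((altnat b).+1, 2))%N.
Proof.
elim: b => [_|x b IHb sb]; first by rewrite block_sizes_nil /altnat /altsum big_ord0.
have {IHb} := IHb (path_sorted sb).
rewrite block_sizes_cons sumn_cat (altnat_cons sb).
case: x sb => [|t] sb.
  by case: b sb => // _; rewrite block_sizes_nil /altnat /altsum big_ord0.
rewrite /= dcoef_cons0 // sumn_nseq; have := altnat_le sb.
rewrite expnS !bin2 /=; move: (2 ^ t)%N (altnat b) => m a le_am.
have -> : (2 * m - a = m + (m - a))%N by lia.
move: (m - a)%N (subnK le_am) => h <-; move: (sumn _) => s.
have -> : uphalf (h + a + h) = (h + uphalf a)%N by lia.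
have -> : (((h + a + h).+1 * (h + a + h)) = (a.+1 * a) + (2 * (h + a) + 1) * h * 2)%N by nia.
by rewrite muln2 halfD odd_double andbF doubleK add0n => <-; lia.
Qed.

(** * Chains in a model of the symmetric square *)

Section SquareModel.
Variables (K : fieldType) (chK : 2%N \in [pchar K]).
Variables (M : lmodType K) (e : {linear M -> M}) (B : nat -> nat -> M).
Hypothesis BC : forall i j, B i j = B j i.
Hypothesis eB : forall i j, e (B i j) = B i.+1 j + B i j.+1.

Lemma addvv (x : M) : x + x = 0.
Proof. by rewrite -mulr2n -scaler_nat (pcharf0 chK) scale0r. Qed.

Lemma addvK (x y : M) : x + (x + y) = y.
Proof. by rewrite addrA addvv add0r. Qed.

Lemma eB_sq i : e (B i i) = 0.
Proof. by rewrite eB BC addvv. Qed.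

Lemma iter_eB_sq k i : (0 < k)%N -> iter k e (B i i) = 0.
Proof. by case: k => // k _; rewrite iterSr eB_sq linear0. Qed.

Lemma iter_eB t i j : iter (2 ^ t) e (B i j) = B (i + 2 ^ t) j + B i (j + 2 ^ t).
Proof.
elim: t i j => [|t IHt] i j; first by rewrite /= eB !addn1.
rewrite expnS mul2n -addnn iterD IHt linearD /= !IHt -!addnA -!addrA; congr (_ + _).
by rewrite addvK.
Qed.

(** Each further power s^(2^(t+1)) kills the square already obtained and splits the other term,
    which yields the next square. *)
Lemma iter_eB_pred t i :
  iter (2 ^ t.+1).-1 e (B i.+1 i) = B (i + 2 ^ t) (i + 2 ^ t) + B (i + 2 ^ t.+1) i.
Proof.
elim: t i => [|t IHt] i; first by rewrite /= eB addrC addn1 addn2.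
have -> : (2 ^ t.+2).-1 = (2 ^ t.+1 + (2 ^ t.+1).-1)%N.
  by have := expn_gt0 2 t.+1; rewrite [(2 ^ t.+2)%N]expnS; lia.
rewrite iterD IHt linearD /= iter_eB_sq ?expn_gt0 // add0r iter_eB addrC.
by rewrite -addnA addnn -mul2n -expnS.
Qed.

(* The K[e]-span of the elements x p^i = B i.+1 i, for i < o. *)
Definition gspan (o : nat) : M -> Prop := esub e (fun x => exists2 i, (i < o)%N & x = B i.+1 i).

Lemma gspan_gen o i : (i < o)%N -> gspan o (B i.+1 i).
Proof. by move=> lt_io; apply: esub_gen; exists i. Qed.

Lemma gspanS o o' x : (o <= o')%N -> gspan o x -> gspan o' x.
Proof.
move=> le_oo'; apply: esub_trans => _ [i lt_io ->].
exact/gspan_gen/(leq_trans lt_io).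
Qed.

Lemma gspan0_eq0 x : gspan 0 x -> x = 0.
Proof. by elim=> [y []//|//|c y z _ -> _ ->|y _ ->]; rewrite ?scaler0 ?addr0 ?linear0. Qed.

(** Induction on the difference of the exponents, by x^(k+2) = s x^(k+1) - p x^k. *)
Lemma B_gen i j :
  esub e (fun x => exists l, x = B l.+1 l \/ x = B l l) (B i j).
Proof.
wlog le_ji : i j / (j <= i)%N.
  by move=> H; case: (leqP j i) => [|/ltnW] /H //; rewrite BC.
rewrite -(subnK le_ji); move: (i - j)%N => k {i le_ji}.
elim/ltn_ind: k j => -[|[|k]] IHk j.
- by apply: esub_gen; exists j; right.
- by apply: esub_gen; exists j; left.
have -> : B (k.+2 + j) j = e (B (k.+1 + j) j) + B (k + j.+1) j.+1.
  by rewrite eB -addrA addSn addnS addvv addr0.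
by apply: esubD; [apply/esubE/IHk|apply: IHk].
Qed.

(** A Horner step: it separates the constant terms of the polynomials in [e] that multiply the
    generators x p^i with o <= i < o + h. *)
Lemma gspan_horner o h x : gspan (o + h) x ->
  exists (d : nat -> K) (r y : M), [/\ gspan o r, gspan (o + h) y &
    x = \sum_(o <= i < o + h) d i *: B i.+1 i + r + e y].
Proof.
elim=> [_ [i lt_i ->]||c y z _ [d [r [w [Fr Fw ->]]]] _ [d' [r' [w' [Fr' Fw' ->]]]]|y Fy _].
- have [lt_io|le_oi] := ltnP i o.
    exists (fun=> 0), (B i.+1 i), 0; split; [exact: gspan_gen|exact: esub0|].
    by rewrite linear0 addr0 big1 ?add0r // => l _; rewrite scale0r.
  exists (fun l => (l == i)%:R), 0, 0; split; [exact: esub0|exact: esub0|].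
  rewrite linear0 !addr0 (bigD1_seq i) ?mem_index_iota ?le_oi ?iota_uniq //=.
  by rewrite eqxx scale1r big1 ?addr0 // => l /negPf ->; rewrite scale0r.
- exists (fun=> 0), 0, 0; split; [exact: esub0|exact: esub0|].
  by rewrite linear0 !addr0 big1 // => l _; rewrite scale0r.
- exists (fun i => c * d i + d' i), (c *: r + r'), (c *: w + w').
  split; [exact: esubP|exact: esubP|].
  rewrite linearP !scalerDr addrACA; congr (_ + _).
  rewrite addrACA; congr (_ + _).
  rewrite scaler_sumr -big_split; apply: eq_bigr => i _.
  by rewrite scalerDl scalerA.
- exists (fun=> 0), 0, y; split=> //; first exact: esub0.
  by rewrite big1 ?add0r // => l _; rewrite scale0r.
Qed.

(* The next two properties say that modulo gspan o the elements B i j with    *)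
(* i, j >= o behave like those of S^2(W_n), shifted by p^o.                   *)
Definition gspan_big o n := forall i j, (o + n <= i)%N -> (o <= j)%N -> gspan o (B i j).

Definition gspan_sq_free o n := forall c : nat -> K,
  gspan o (\sum_(o <= i < o + n) c i *: B i i) ->
  forall i, (o <= i < o + n)%N -> c i = 0.

Section Step.
Variables (o h t : nat).
Hypothesis le_h : (h <= 2 ^ t)%N.
Hypothesis Fbig : gspan_big o (2 ^ t + h).
Hypothesis Ffree : gspan_sq_free o (2 ^ t + h).

(** Since 2^(t+1) >= 2^t + h, both terms of s^(2^(t+1)) x p^i with i >= o have an exponent large
    enough for [Fbig]. *)
Lemma iter_gspan o' x : gspan o' x -> gspan o (iter (2 ^ t.+1) e x).
Proof.
apply: esub_map => _ [i _ ->]; have [lt_io|le_oi] := ltnP i o.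
  exact/esub_iter/gspan_gen.
have := expnS 2 t => E.
rewrite iter_eB; apply: esubD; last rewrite BC; apply: Fbig; lia.
Qed.

Lemma iter_pred_sum (d : nat -> K) : exists2 r, gspan o r &
  iter (2 ^ t.+1).-1 e (\sum_(o <= i < o + h) d i *: B i.+1 i) =
  \sum_(o + 2 ^ t <= i < o + (2 ^ t + h)) d (i - 2 ^ t)%N *: B i i + r.
Proof.
exists (\sum_(o <= i < o + h) d i *: B (i + 2 ^ t.+1) i).
  rewrite big_nat; apply: esub_sum => i /andP[le_oi lt_i].
  by have := expnS 2 t => E; apply/esubZ/Fbig; lia.
rewrite linear_sum /= addnA addnAC (big_addn _ _ (2 ^ t)) !addnK -big_split.
by apply: eq_bigr => i _; rewrite linearZ /= iter_eB_pred scalerDr addnK.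
Qed.

(** Freeness of the h blocks modulo [gspan o]: in a free module over K[s]/(s^N), whatever s^(N-l)
    kills is divisible by s^l. Factors of [e] are extracted one at a time; the constant terms [d] of
    the current quotient vanish because e^(N-1) turns them into coefficients of independent
    squares. *)
Lemma gspan_div l f : (l <= 2 ^ t.+1)%N -> gspan (o + h) f ->
  gspan o (iter (2 ^ t.+1 - l) e f) ->
  exists r y, [/\ gspan o r, gspan (o + h) y & f = r + iter l e y].
Proof.
move=> + Ff; elim: l => [|l IHl] lt_l Fe.
  by exists 0, f; split=> //; rewrite ?add0r //; exact: esub0.
have [|r [y [Fr Fy def_f]]] := IHl (ltnW lt_l).
  by rewrite -(subnSK lt_l) iterS; apply: esubE.
have [d [r' [z [Fr' Fz def_y]]]] := gspan_horner Fy.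
have [r2 Fr2 Ed] := iter_pred_sum d.
have d0 i : (o <= i < o + h)%N -> d i = 0.
  move=> /andP[le_oi lt_i].
  (* [d] shifted by 2^t, where [iter_pred_sum] puts the squares, and padded with zeros to the full
     range of [Ffree]. *)
  pose c j := if (o + 2 ^ t <= j)%N then d (j - 2 ^ t)%N else 0.
  have <- : c (i + 2 ^ t)%N = d i by rewrite /c leq_add2r le_oi addnK.
  apply: Ffree; last lia.
  rewrite (big_cat_nat (n := (o + 2 ^ t)%N)) ?leq_addr //=; last lia.
  rewrite [X in X + _]big_nat big1 ?add0r => [|j /andP[_ lt_j]]; last first.
    by rewrite /c leqNgt lt_j scale0r.
  rewrite big_nat (eq_bigr (fun j => d (j - 2 ^ t)%N *: B j j)); last first.
    by move=> j /andP[le_j _]; rewrite /c le_j.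
  rewrite -big_nat; apply: (esub_addl Fr2); rewrite addrC -Ed.
  have Fz' := iter_gspan Fz.
  apply: (esub_addl (esub_iter (2 ^ t.+1).-1 Fr')); rewrite -linearD.
  apply: (esub_addl Fz'); rewrite -{1}(prednK (expn_gt0 2 t.+1)) iterSr -linearD.
  rewrite addrC [r' + _]addrC -def_y /=.
  have -> : (2 ^ t.+1).-1 = (2 ^ t.+1 - l.+1 + l)%N by lia.
  apply: (esub_addl (esub_iter (2 ^ t.+1 - l.+1) Fr)).
  by rewrite iterD -linearD -def_f.
exists (r + iter l e r'), z; split=> //; first exact/esubD/esub_iter.
rewrite -addrA iterSr -linearD def_f def_y big_nat big1 ?add0r // => i.
by move/d0->; rewrite scale0r.
Qed.

(** Shifting 2^t from one exponent to the other costs a multiple of s^(2^t). That power kills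
    squares, and it sends x p^l with l >= o + h to terms already covered by [Fbig]. *)
Lemma gspan_big_step : gspan_big (o + h) (2 ^ t - h).
Proof.
move=> i j le_i le_j.
have [ge_i|lt_i] := leqP (o + (2 ^ t + h)) i.
  by apply: gspanS (leq_addr _ _) (Fbig ge_i _); lia.
have -> : B i j = iter (2 ^ t) e (B (i - 2 ^ t) j) + B (j + 2 ^ t) (i - 2 ^ t).
  by rewrite iter_eB -addrA [B (j + _) _]BC addvv addr0 subnK //; lia.
apply: esubD; last by apply: gspanS (leq_addr h _) (Fbig _ _); lia.
apply: esub_map (B_gen _ _) => _ [l [->|->]]; last first.
  by rewrite iter_eB_sq ?expn_gt0 //; apply: esub0.
have [lt_l|le_l] := ltnP l (o + h); first exact/esub_iter/gspan_gen.
rewrite iter_eB [B l.+1 _]BC; apply: gspanS (leq_addr h o) _.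
by apply: esubD; apply: Fbig; lia.
Qed.

(** A combination f of squares is killed by [e], so if it lies in the new blocks it lies in their
    socle, spanned modulo [gspan o] by the p^(i + 2^t) with o <= i < o + h. These exponents are
    disjoint from those in f, so [Ffree] applies to the difference. *)
Lemma gspan_sq_free_step : gspan_sq_free (o + h) (2 ^ t - h).
Proof.
rewrite /gspan_sq_free -addnA subnKC // => c; set f := \sum_(_ <= i < _) _ => Ff.
have gt0 := expn_gt0 2 t; have E := expnS 2 t.
have [|r [y [Fr Fy def_f]]] := gspan_div (leq_pred (2 ^ t.+1)) Ff.
  have -> : (2 ^ t.+1 - (2 ^ t.+1).-1)%N = 1 by lia.
  rewrite /= linear_sum big1 => [|i _]; first exact: esub0.
  by rewrite linearZ /= eB_sq scaler0.
have [d [r' [z [Fr' Fz def_y]]]] := gspan_horner Fy.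
have [r2 Fr2 Ed] := iter_pred_sum d.
(* The coefficients of f and those of the socle element, glued along their disjoint ranges. *)
pose c' i := if (i < o + h)%N then 0 else
  if (i < o + 2 ^ t)%N then c i else - d (i - 2 ^ t)%N.
move=> i /andP[le_i lt_i].
have <- : c' i = c i by rewrite /c' ltnNge le_i lt_i.
apply: Ffree; last lia.
rewrite (big_cat_nat (n := (o + 2 ^ t)%N)) ?leq_addr //=; last lia.
rewrite (big_cat_nat (n := (o + h)%N)) ?leq_addr //=; last lia.
rewrite [X in X + _ + _]big_nat big1 ?add0r => [|j /andP[_ lt_j]]; last first.
  by rewrite /c' lt_j scale0r.
have -> : \sum_(o + h <= j < o + 2 ^ t) c' j *: B j j = f.
  rewrite big_nat [f]big_nat; apply: eq_bigr => j /andP[le_j lt_j].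
  by rewrite /c' lt_j ltnNge le_j.
rewrite big_nat (eq_bigr (fun j => - (d (j - 2 ^ t)%N *: B j j))); last first.
  move=> j /andP[le_j lt_j]; rewrite /c' (ltnNge _ (o + 2 ^ t)) le_j /= -scaleNr.
  by case: ltnP => //; lia.
rewrite -big_nat sumrN def_f def_y -addrA; apply: esubD => //.
rewrite !linearD /= Ed -iterSr prednK ?expn_gt0 //.
rewrite addrC !addrA addNr add0r.
by apply: esubD; [apply: esubD => //; exact: esub_iter|exact: iter_gspan Fz].
Qed.

End Step.

(* In the inductive step, for a generator g found modulo gspan (o + h) with    *)
(* e^l g in gspan (o + h), iter_gspan puts e^(2 ^ t.+1) g in gspan o, so that  *)
(* gspan_div corrects g to a vector killed by e^l modulo gspan o.              *)
Lemma square_chains b o : sorted gtn b ->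
    gspan_big o (altnat b) -> gspan_sq_free o (altnat b) ->
  (forall i, (i < size (block_sizes b))%N -> exists2 g,
      gspan (o + i) (g - B (o + i).+1 (o + i)) &
      gspan o (iter (nth 0%N (block_sizes b) i) e g)) /\
  (forall i j, (o + uphalf (altnat b) <= i)%N -> (o + (altnat b)./2 <= j)%N ->
      gspan (o + (altnat b)./2) (B i j)).
Proof.
elim: b o => [|x b IHb] o sb.
  rewrite block_sizes_nil /altnat /altsum big_ord0 => Fbig _; split=> // i j.
  by rewrite addn0 => le_i le_j; apply: Fbig; rewrite ?addn0.
rewrite block_sizes_cons (altnat_cons sb); case: x sb => [|t] sb /=.
  case: b sb {IHb} => // _; rewrite block_sizes_nil /altnat /altsum big_ord0 => Fbig _.
  by split=> // i j; rewrite subn0 addn0 => le_i le_j; apply: Fbig.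
have le_b := altnat_le sb; rewrite dcoef_cons0 //; set h := (2 ^ t - altnat b)%N.
have le_h : (h <= 2 ^ t)%N by rewrite leq_subr.
have def_n : (2 ^ t.+1 - altnat b = 2 ^ t + h)%N by rewrite /h expnS; lia.
have def_b : altnat b = (2 ^ t - h)%N by rewrite subKn.
rewrite def_n => Fbig Ffree.
have [|||chain_b small_b] := IHb (o + h)%N; first exact: path_sorted sb.
- by rewrite def_b; apply: gspan_big_step.
- by rewrite def_b; apply: gspan_sq_free_step.
split=> [i|i j le_i le_j]; last first.
  have <- : (o + h + (altnat b)./2 = o + (2 ^ t + h)./2)%N by lia.
  apply: small_b; lia.
rewrite size_cat size_nseq nth_cat size_nseq nth_nseq => lt_i.
have [lt_ih|le_hi] := ltnP i h.
  exists (B (o + i).+1 (o + i)); first by rewrite subrr; apply: esub0.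
  exact: (iter_gspan le_h Fbig (gspan_gen (ltnSn _))).
have [|g Fg Feg] := chain_b (i - h)%N; first lia.
have def_i : (o + h + (i - h) = o + i)%N by lia.
rewrite def_i in Fg; set l := nth _ _ _ in Feg *.
have le_l : (l <= 2 ^ t.+1)%N.
  by apply: (allP (block_sizes_le sb)); rewrite mem_nth // ltn_subLR.
have [|r [y [Fr Fy def_g]]] := gspan_div le_h Fbig Ffree le_l Feg.
  rewrite -iterD subnK //; apply: (iter_gspan le_h Fbig (o' := (o + i).+1)).
  rewrite -(subrK (B (o + i).+1 (o + i)) g).
  by apply: esubD; [apply: gspanS Fg|apply: gspan_gen].
exists (g - y); last by rewrite linearB /= def_g addrK.
by rewrite addrAC; apply: esubB => //; apply: gspanS Fy; lia.
Qed.

End SquareModel.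

(** * Equivariant maps out of sums of Jordan blocks *)

Lemma all2_cat (S T : Type) (r : S -> T -> bool) s1 s2 t1 t2 : size s1 = size t1 ->
  all2 r (s1 ++ s2) (t1 ++ t2) = all2 r s1 t1 && all2 r s2 t2.
Proof. by elim: s1 t1 => [|x s1 IHs] [|y t1] //= [/IHs->]; rewrite andbA. Qed.

Section Covering.
Variables (K : fieldType) (chK : 2%N \in [pchar K]) (alpha : nat).
Variable i0 : 'I_alpha.
Hypothesis i0_eq0 : i0 = 0%N :> nat.
Local Notation L := (wq chK alpha).
Variables (M : liemod L) (rM : restricted M).
Local Notation e := (act (wq_e chK i0) : M -> M).

Definition equivariant (N : liemod L) (f : {linear N -> M}) :=
  forall (x : L) v, f (act x v) = act x (f v).

Lemma act_wq_e i (v : M) : act (wq_e chK i) v = iter (2 ^ i) e v.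
Proof.
case: i => i lt_i /=; elim: i => [|i IHi] in lt_i v *.
  by congr (act (wq_e chK _) v); apply: val_inj.
have lt_i' := ltnW lt_i.
rewrite -(wq_e_sqm chK (i := Ordinal lt_i')) // rM comp_lfunE !IHi.
by rewrite expnS mul2n -addnn iterD.
Qed.

Lemma act_wq (x : L) (v : M) :
  act x v = \sum_i (x : 'rV_alpha) 0 i *: iter (2 ^ i) e v.
Proof.
rewrite {1}[x](row_sum_delta (x : 'rV_alpha)).
rewrite (linear_comb (h := @act _ _ M) _ _ (@act_linear _ _ M)) sum_lfunE.
by apply: eq_bigr => i _; rewrite scale_lfunE -act_wq_e.
Qed.

(** The existence half of a universal property: N behaves as the sum of the K[e]/(e^l) for l in
    [ls], tested against the fixed target M. *)
Definition free_on (N : liemod L) (ls : seq nat) := forall gs : seq M,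
  all2 (fun l g => iter l e g == 0) ls gs ->
  exists2 f : {linear N -> M}, equivariant f & forall g, g \in gs -> exists v, f v = g.

Section Chain.
Variables (l : nat) (g : M).
Hypothesis eg0 : iter l e g = 0.

(** [jordan0] has its ones above the diagonal, so the last basis vector generates W_l and is the one
    sent to g; hence the exponent l - i - 1. *)
Definition chain_map (v : W chK alpha l) : M :=
  \sum_(i < l) (v : 'cV_l) i 0 *: iter (l - i.+1) e g.

Fact chain_map_linear : linear chain_map.
Proof.
move=> a u v; rewrite /chain_map scaler_sumr -big_split; apply: eq_bigr => i _.
by rewrite !mxE scalerDl scalerA.
Qed.

HB.instance Definition _ := GRing.isSemilinear.Build K (W chK alpha l) M _ chain_map
  (GRing.semilinear_linear chain_map_linear).

Lemma chain_map_jordan (v : 'cV[K]_l) : chain_map (jordan0 K l *m v) = e (chain_map v).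
Proof.
rewrite /chain_map linear_sum; case: l eg0 v => [|k] ekg v; first by rewrite !big_ord0.
rewrite big_ord_recr big_ord_recl /=.
have -> : (jordan0 K k.+1 *m v) ord_max 0 = 0.
  by rewrite mxE big1 // => j _; rewrite mxE gtn_eqF ?mul0r ?ltn_ord.
rewrite linearZ /= subn1 /= -iterS ekg scaler0 scale0r addr0 add0r.
apply: eq_bigr => i _; rewrite linearZ /= subSS; congr (_ *: _).
  rewrite mxE (bigD1 (lift ord0 i)) //= mxE /= eqxx mul1r big1 ?addr0 // => j.
  by rewrite -val_eqE /= mxE eq_sym => /negPf; rewrite /bump /= add1n => ->; rewrite mul0r.
by rewrite /bump /= add1n subSS -[in LHS](subnSK (ltn_ord i)).
Qed.

Lemma chain_map_equivariant : equivariant chain_map.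
Proof.
move=> x v; rewrite act_wq /= jordan_actE /jordan_mx mulmx_suml.
rewrite (linear_sum chain_map); apply: eq_bigr => i _ /=.
rewrite -scalemxAl (linearZ_LR chain_map) /=; congr (_ *: _).
elim: (2 ^ i)%N => [|k IHk]; first by rewrite expr0 mul1mx.
by rewrite exprS -mulmxE -mulmxA chain_map_jordan IHk.
Qed.

Lemma chain_map_gen : exists v, chain_map v = g.
Proof.
rewrite /chain_map; case: l eg0 => [/= ->|k _]; first by exists 0; rewrite big_ord0.
exists (delta_mx ord_max 0); rewrite big_ord_recr /= subnn mxE !eqxx scale1r.
rewrite big1 ?add0r // => i _; rewrite mxE andbT -val_eqE /= ltn_eqF ?scale0r //.
Qed.

End Chain.

Lemma free_on_W l : free_on (W chK alpha l) [:: l].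
Proof.
case=> [|g [|g' gs]]; rewrite /= ?andbF ?andbT // => /eqP eg0; exists (@chain_map l g).
  exact: chain_map_equivariant.
by move=> _ /predU1P[->|//]; apply: chain_map_gen.
Qed.

Lemma free_on_W0 : free_on (W chK alpha 0) [::].
Proof.
case=> // _; exists (@chain_map 0 0) => //.
by apply: chain_map_equivariant.
Qed.

Section Sum.
Variables (N1 N2 : liemod L) (f1 : {linear N1 -> M}) (f2 : {linear N2 -> M}).

Definition dsum_map (u : dsum N1 N2) : M := f1 u.1 + f2 u.2.

Fact dsum_map_linear : linear dsum_map.
Proof. by move=> a u v; rewrite /dsum_map !linearP scalerDr addrACA. Qed.

HB.instance Definition _ := GRing.isSemilinear.Build K (dsum N1 N2) M _ dsum_map
  (GRing.semilinear_linear dsum_map_linear).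

End Sum.

Lemma free_on_dsum N1 N2 l1 l2 :
  free_on N1 l1 -> free_on N2 l2 -> free_on (dsum N1 N2) (l1 ++ l2).
Proof.
move=> free1 free2 gs.
rewrite -{1}(cat_take_drop (size l1) gs) => H.
have sz : size l1 = size (take (size l1) gs).
  move: H; rewrite all2E => /andP[/eqP sz _]; move: sz.
  by rewrite cat_take_drop size_cat => sz; rewrite size_takel // -sz leq_addr.
move: H; rewrite all2_cat // => /andP[/free1[f1 eq1 im1] /free2[f2 eq2 im2]].
exists (dsum_map f1 f2) => [x u|g].
  by rewrite /= /dsum_map dsum_actE /= eq1 eq2 linearD.
rewrite -(cat_take_drop (size l1) gs) mem_cat => /orP[/im1|/im2] [v <-].
  by exists (v, 0); rewrite /= /dsum_map /= linear0 addr0.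
by exists (0, v); rewrite /= /dsum_map /= linear0 add0r.
Qed.

Lemma free_on_dpow N l d : free_on N [:: l] -> free_on (dpow N d) (nseq d l).
Proof.
move=> freeN; elim: d => [|d IHd]; first exact: free_on_W0.
exact: (free_on_dsum freeN IHd).
Qed.

End Covering.

(** * Dimension and universal property of the symmetric square *)

Section SymmetricSquareDim.
Variables (K : fieldType) (L : lie2 K) (M : liemod L).

Lemma dim_symrel : (\dim (symrel M) <= 'C(dim M, 2))%N.
Proof.
set d := dim M; set b := vbasis {:M}.
pose r i j := tens b`_i b`_j - tens b`_j b`_i.
suff sub : (symrel M <= <<[seq r i j | j <- iota 0 d, i <- iota 0 j]>>)%VS.
  apply: leq_trans (dimvS sub) (leq_trans (dim_span _) _).
  rewrite size_allpairs_dep sumnE big_map -bin2_sum /index_iota subn0.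
  by rewrite leq_eqVlt; apply/orP; left; apply/eqP/eq_bigr => j _; rewrite size_iota.
have r_mem i j : (i < j < d)%N -> r i j \in <<[seq r i j | j <- iota 0 d, i <- iota 0 j]>>%VS.
  move=> /andP[lt_ij lt_jd]; apply/memv_span/allpairsPdep.
  by exists j, i; rewrite !mem_iota.
apply/span_subvP => _ /allpairsP[[v w] /= [/(nthP 0)[i lt_i <-] /(nthP 0)[j lt_j <-] ->]].
rewrite size_tuple dimvf -/d in lt_i lt_j; rewrite -[X in X \in _]/(r i j).
case: (ltngtP i j) => [lt_ij|lt_ji|->]; first by rewrite r_mem ?lt_ij.
  by rewrite /r -opprB rpredN; apply: r_mem; rewrite lt_ji.
by rewrite /r subrr mem0v.
Qed.

(** The bound in this direction is what makes a surjection from a module of dimension C(n+1, 2)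
    injective. *)
Lemma dim_sym2 : ('C((dim M).+1, 2) <= dim (sym2_sort M))%N.
Proof.
have -> : dim (sym2_sort M) = \dim ((symrel M)^C)%VS by [].
rewrite dimv_compl dimvf.
have -> : dim (tensor2 M) = (\dim {:M} * \dim {:M})%N by [].
by rewrite dimvf; have := dim_symrel; rewrite !bin2 /= ; nia.
Qed.

Lemma sym2_universal (U : vectType K) (b : M -> M -> U) :
    (forall w, linear (b^~ w)) -> (forall v, linear (b v)) ->
    (forall v w, b v w = b w v) ->
  exists2 f : sym2_sort M -> U, linear f & forall v w, f (sprod v w) = b v w.
Proof.
move=> bl br bC; have [g gP [gE _]] := tens_universal bl br.
pose gl : {linear tensor2 M -> U} := HB.pack g
  (GRing.isSemilinear.Build K _ _ _ g (GRing.semilinear_linear gP)).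
have sub : (symrel M <= lker (linfun gl))%VS.
  apply: symrel_min => v w; rewrite memv_ker lfunE linearB /=.
  by rewrite !gE bC subrr.
exists (fun u => gl (vsval u)) => [a u v|v w]; first by rewrite !linearP.
rewrite -gE; apply/eqP; rewrite -subr_eq0 -[g]/(gl : _ -> _) -linearB /=.
have /(subvP sub) : vsval (sprod v w) - tens v w \in symrel M.
  by rewrite -qpi_eq0 linearB /= qpi_vsval subrr.
by rewrite memv_ker lfunE.
Qed.

Lemma sprod_linearl w : linear (@sprod K L M ^~ w).
Proof. by move=> a u v; rewrite /sprod tens_linearl linearP. Qed.

Lemma sprod0l w : @sprod K L M 0 w = 0.
Proof. by have /= := sprod_linearl w (-1) 0 0; rewrite !scaleN1r !addNr. Qed.

Lemma sprod_linearr v : linear (@sprod K L M v).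
Proof. by move=> a u w; rewrite /sprod tens_linearr linearP. Qed.

Lemma sprodC v w : @sprod K L M v w = sprod w v.
Proof.
apply/eqP; rewrite -subr_eq0 /sprod -linearB /=.
by rewrite qpi_eq0 tens_swap_mem.
Qed.

Lemma sym2_sprod_ind (P : sym2_sort M -> Prop) : P 0 ->
  (forall (c : K) u v, P u -> P v -> P (c *: u + v)) -> (forall v w, P (sprod v w)) ->
  forall u, P u.
Proof.
move=> P0 PP Ps; elim/sym2_ind => X; rewrite [X]tensor2_sum pair_big /= linear_sum.
by elim/big_rec: _ => // i u _ Pu; rewrite linearZ /=; apply: PP => //; apply: Ps.
Qed.

End SymmetricSquareDim.

Lemma surj_bij (K : fieldType) (V U : vectType K) (f : {linear V -> U}) :
  (forall u, exists v, f v = u) -> (dim V <= dim U)%N -> bijective f.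
Proof.
move=> surj_f le_d; pose l := linfun f.
have lE v : l v = f v by rewrite lfunE.
have im_l u : u \in limg l.
  by have [v <-] := surj_f u; rewrite -lE; apply/memv_img/memvf.
have ker0 : lker l == 0%VS.
  rewrite -dimv_eq0; have := limg_ker_dim l fullv.
  have -> : limg l = fullv by apply/vspaceP => u; rewrite im_l memvf.
  by rewrite capfv !dimvf; lia.
exists (l^-1)%VF => u; first by rewrite -lE lker0_lfunK.
by rewrite -lE limg_lfunVK.
Qed.

(** * The model inside the symmetric square of W_n *)

Section JordanSquare.
Variables (K : fieldType) (chK : 2%N \in [pchar K]) (alpha : nat) (n : nat).
Local Notation V := (W chK alpha n).

(* Corresponds to x^i in K[x]/(x^n); it vanishes for i >= n. *)
Definition jvec (i : nat) : V := \col_(k < n) (k + i.+1 == n)%N%:R.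

Lemma jordan_jvec i : jordan0 K n *m (jvec i : 'cV_n) = jvec i.+1.
Proof.
apply/colP => k; rewrite !mxE; have [lt_k|ge_k] := ltnP k.+1 n.
  rewrite (bigD1 (Ordinal lt_k)) //= !mxE eqxx mul1r addSnnS big1 ?addr0 // => j.
  by rewrite -val_eqE /= mxE eq_sym => /negPf->; rewrite mul0r.
rewrite big1 => [|j _]; last by rewrite mxE gtn_eqF ?mul0r // (leq_trans (ltn_ord j)).
by rewrite gtn_eqF //; lia.
Qed.

Lemma jvec_sum (v : V) : v = \sum_(k < n) (v : 'cV_n) k 0 *: jvec (n - k.+1).
Proof.
apply/colP => k; rewrite summxE (bigD1 k) //= !mxE subnSK // subnKC ?eqxx ?mulr1; last first.
  exact: ltnW.
rewrite big1 ?addr0 // => j /negPf; rewrite -val_eqE /= => kj; rewrite !mxE.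
by have := ltn_ord j => lt_j; case: eqP => [|_]; rewrite ?mulr0 //; lia.
Qed.

Lemma jvec_big i : (n <= i)%N -> jvec i = 0.
Proof. by move=> le_i; apply/colP => k; rewrite !mxE gtn_eqF //; lia. Qed.

Definition jsq i j : sym2 V := sprod (jvec i) (jvec j).

Lemma jsqC i j : jsq i j = jsq j i.
Proof. exact: sprodC. Qed.

Lemma act_jsq (i0 : 'I_alpha) i j : i0 = 0%N :> nat ->
  act (wq_e chK i0) (jsq i j) = jsq i.+1 j + jsq i j.+1.
Proof.
move=> i0_eq0; have eE v : act (wq_e chK i0) (v : V) = jordan0 K n *m (v : 'cV_n).
  by rewrite /= jordan_actE jordan_mx_e i0_eq0 expr1.
by rewrite [LHS](sym2_act_sprod (M := V)) !eE !jordan_jvec.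
Qed.

Lemma jsq_big i j : (n <= i)%N -> jsq i j = 0.
Proof.
by move=> le_i; rewrite /jsq jvec_big //; apply: sprod0l.
Qed.

(** The symmetric form v_a w_a, with a the only nonzero coordinate of x^i, induces a functional on
    the symmetric square that reads off the coefficient of p^i. *)
Lemma jsq_free (c : nat -> K) :
  \sum_(0 <= i < n) c i *: jsq i i = 0 -> forall i, (i < n)%N -> c i = 0.
Proof.
move=> sum0 i lt_i; have lt_a : (n - i.+1 < n)%N by lia.
pose a := Ordinal lt_a.
have [||v w|f fP fE] := @sym2_universal _ _ V K^o (fun v w => (v : 'cV_n) a 0 * (w : 'cV_n) a 0).
- by move=> w k u v; rewrite !mxE mulrDl -mulrA.
- by move=> v k u w; rewrite !mxE mulrDr mulrCA.
- exact: mulrC.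
have := congr1 f sum0; rewrite big_mkord (linear_comb _ _ fP).
have -> : f 0 = 0 by have /= := fP (-1) 0 0; rewrite !scaleN1r !addNr.
rewrite (bigD1 (Ordinal lt_i)) //= fE !mxE subnK // eqxx mulr1 -[_ *: _]/(_ * _) mulr1.
rewrite big1 ?addr0 // => j; rewrite -val_eqE fE !mxE /= => ji.
by rewrite (_ : (_ == n) = false) ?mulr0 ?scaler0 //; lia.
Qed.

Lemma jsq_span (P : sym2 V -> Prop) : P 0 ->
  (forall (c : K) u v, P u -> P v -> P (c *: u + v)) -> (forall i j, P (jsq i j)) ->
  forall u, P u.
Proof.
move=> P0 PP Pj; apply: sym2_sprod_ind => // v w.
have Psum (I : finType) (a : I -> K) (x : I -> sym2 V) :
    (forall i, P (x i)) -> P (\sum_i a i *: x i).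
  by move=> Px; elim/big_rec: _ => // i y _; apply: PP.
rewrite [v]jvec_sum (linear_comb _ _ (sprod_linearl w)); apply: (Psum) => i.
rewrite [w]jvec_sum (linear_comb _ _ (sprod_linearr _)); apply: (Psum) => j.
exact: Pj.
Qed.

End JordanSquare.

(** * Assembling the isomorphism *)

Lemma all2_map (I S T : Type) (r : S -> T -> bool) (f : I -> S) (g : I -> T) s :
  all2 r (map f s) (map g s) = all (fun i => r (f i) (g i)) s.
Proof. by elim: s => //= i s ->. Qed.

Lemma dim_W (K : fieldType) (chK : 2%N \in [pchar K]) (alpha l : nat) :
  dim (W chK alpha l) = l.
Proof. by rewrite -[RHS]muln1. Qed.

Lemma dim_dpow (K : fieldType) (chK : 2%N \in [pchar K]) (alpha : nat)
  (N : liemod (wq chK alpha)) d : dim (dpow N d) = (d * dim N)%N.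
Proof.
elim: d => [|d IHd]; first exact: dim_W.
by rewrite mulSn -IHd.
Qed.

Lemma dim_block_sum (K : fieldType) (chK : 2%N \in [pchar K]) (alpha : nat) b :
  dim (\big[@dsum K (wq chK alpha) / W chK alpha 0]_(k < size b | (0 < nth 0%N b k)%N)
          dpow (W chK alpha (2 ^ nth 0%N b k)) `|dcoef b k|%N) = sumn (block_sizes b).
Proof.
rewrite /block_sizes; elim/big_rec2: _ => [|k s N _ dimN]; first exact: dim_W.
rewrite sumn_cat sumn_nseq -dimN [RHS]addnC addnC mulnC.
by rewrite -{2}(dim_W chK alpha (2 ^ _)) -dim_dpow.
Qed.

Lemma free_on_block_sum (K : fieldType) (chK : 2%N \in [pchar K]) (alpha : nat)
    (i0 : 'I_alpha) (i0_eq0 : i0 = 0%N :> nat) (M : liemod (wq chK alpha))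
    (rM : restricted M) b :
  free_on i0 M
    (\big[@dsum K (wq chK alpha) / W chK alpha 0]_(k < size b | (0 < nth 0%N b k)%N)
        dpow (W chK alpha (2 ^ nth 0%N b k)) `|dcoef b k|%N) (block_sizes b).
Proof.
rewrite /block_sizes; elim/big_rec2: _ => [|k s N _ freeN]; first exact: free_on_W0.
by apply: free_on_dsum freeN; apply/free_on_dpow/free_on_W.
Qed.

Theorem theorem1p7 (K : fieldType) (chK : 2%N \in [pchar K])
    (alpha : nat) (alpha_gt0 : (0 < alpha)%N)
    (n : nat) (n_gt0 : (0 < n)%N) (n_le_q : (n <= 2 ^ alpha)%N)
    (b : seq nat) (n_b : consecutive_ones n b) :
  liemod_iso (sym2 (W chK alpha n))
    (dsum (dpow (W chK alpha 1) (uphalf n))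
       (\big[@dsum K (wq chK alpha) / W chK alpha 0]_(k < size b
            | (0 < nth 0%N b k)%N)
          dpow (W chK alpha (2 ^ nth 0%N b k)) `|dcoef b k|%N)).
Proof.
have [sb def_n _] := n_b.
have {}def_n : altnat b = n by rewrite /altnat def_n.
set M := sym2 _; set N := dsum _ _.
have rM : restricted M by apply/restricted_sym2/restricted_W.
pose i0 := Ordinal alpha_gt0; have i0_eq0 : i0 = 0%N :> nat by [].
pose e : {linear M -> M} := act (wq_e chK i0).
pose B i j : M := jsq chK alpha n i j.
have BC i j : B i j = B j i by apply: jsqC.
have eB i j : e (B i j) = B i.+1 j + B i j.+1 by apply: act_jsq.
(* At o = 0 the span [gspan 0] is zero, so the congruences become equalities; the invariants hold
   since x^n = 0 and by [jsq_free]. *)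
have [] := @square_chains _ chK _ e B BC eB b 0 sb.
- by rewrite def_n => i j le_i _; rewrite /B jsq_big //; apply: esub0.
- rewrite def_n => c /gspan0_eq0 c0 i /andP[_ lt_i].
  exact: (@jsq_free _ chK alpha n c).
have size_b := size_block_sizes sb; rewrite def_n in size_b *.
rewrite !add0n -size_b; set s := size _ in size_b * => chains small.
pose P (i : 'I_s) x :=
  gspan e B i (x - B i.+1 i) /\ iter (nth 0%N (block_sizes b) i) e x = 0.
have [i|g gP {chains}] := @fin_all_exists _ (fun=> M) P.
  by have [g Fg /gspan0_eq0 eg0] := chains i (ltn_ord i); exists g.
pose sq := [seq B i i | i <- iota 0 (uphalf n)].
pose gs := [seq g i | i <- enum 'I_s].
have freeN : free_on i0 M N (nseq (uphalf n) 1%N ++ block_sizes b).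
  apply: free_on_dsum; last exact: free_on_block_sum.
  by apply: free_on_dpow => //; apply: free_on_W.
have [|f f_eq f_im] := freeN (sq ++ gs).
  rewrite all2_cat; last by rewrite size_nseq size_map size_iota.
  apply/andP; split.
    rewrite (_ : nseq _ _ = [seq 1%N | i <- iota 0 (uphalf n)]).
      by rewrite all2_map; apply/allP => i _; apply/eqP; apply: (eB_sq chK BC eB).
    by rewrite -[in LHS](size_iota 0 (uphalf n)); elim: (iota _ _) => //= _ r ->.
  rewrite -{1}(mkseq_nth 0%N (block_sizes b)) /mkseq -/s -val_enum_ord -map_comp all2_map.
  by apply/allP => i _; apply/eqP; have [_] := gP i.
have f_sub u : esub e (fun x => x \in sq ++ gs) u -> exists v, f v = u.
  elim=> [x /f_im//||c x y _ [v <-] _ [w <-]|x _ [v <-]].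
  - by exists 0; rewrite linear0.
  - by exists (c *: v + w); rewrite linearP.
  - by exists (act (wq_e chK i0) v); rewrite f_eq.
(* The change from the x p^j to the g_j is unitriangular, so it can be inverted by induction. *)
have F_sub i : (i <= s)%N -> forall u, gspan e B i u -> esub e (fun x => x \in sq ++ gs) u.
  elim/ltn_ind: i => i IHi le_i u; apply: esub_trans => _ [j lt_j ->].
  have lt_js := leq_trans lt_j le_i.
  have [Fg _] := gP (Ordinal lt_js).
  rewrite -(subKr (g (Ordinal lt_js)) (B j.+1 j)).
  apply: esubB; last exact: (IHi _ lt_j (ltnW lt_js) _ Fg).
  by apply: esub_gen; rewrite mem_cat map_f ?orbT // mem_enum.
have f_surj u : exists v, f v = u.
  apply: f_sub; elim/jsq_span: u => [|c u v|i j]; [exact: esub0|exact: esubP|].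
  (* Here s = n/2 rounded down. A square p^l with l >= [uphalf n], or x p^l with l >= s, falls under
     [small]. *)
  have le_s : (s <= uphalf n)%N by rewrite size_b; lia.
  apply: esub_trans (B_gen chK BC eB i j) => _ [l [->|->]].
    have [lt_l|le_l] := ltnP l s; first exact/(F_sub s)/gspan_gen.
    by apply: (F_sub s) => //; apply: small => //; rewrite size_b in le_l *; lia.
  have [lt_l|le_l] := ltnP l (uphalf n).
    by apply: esub_gen; rewrite mem_cat (map_f (fun i => B i i)) // mem_iota.
  by apply: (F_sub s) => //; apply: small => //; apply: leq_trans le_l.
have dimN : dim N = 'C(n.+1, 2).
  have -> : dim N = (dim (dpow (W chK alpha 1) (uphalf n)) + sumn (block_sizes b))%N.
    by rewrite -(dim_block_sum chK alpha).
  by rewrite dim_dpow dim_W muln1 -def_n sumn_block_sizes.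
have [|f' fK f'K] := surj_bij f_surj.
  by rewrite dimN -{1}(dim_W chK alpha n); apply: dim_sym2.
pose lf' : {linear M -> N} := HB.pack f'
  (GRing.isSemilinear.Build K _ _ _ f' (GRing.semilinear_linear (can2_linear fK f'K))).
exists lf'; split; first by exists f.
by move=> x v; apply: (can_inj fK); rewrite f_eq !f'K.
Qed.
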